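(* Let $m,l,t\ge1$. For $1\le i\le t$ let $g_i(x)$ be a monic divisor of $x^m-1$, $h_i(x)=\frac{x^m-1}{g_i(x)}$, and let $k_{i1}(x),\dots,k_{il}(x)\in\mathcal{R}$ with $\gcd(k_{i1},\dots,k_{il},h_i)=1$. Let $\mathcal{C}\subseteq\mathbb{F}^{ml}$ be the QC code generated by the $t$ tuples $(k_{i1}g_i,\dots,k_{il}g_i)$, $1\le i\le t$. Then: (A) (Here $\mathbb{F}=\mathbb{F}_q$.) $\mathcal{C}$ is Euclidean self-orthogonal if and only if for all $1\le r\le s\le t$: $h_r(x)\mid \overline{g_s}(x)\sum_{j=1}^{l}k_{rj}(x)\overline{k_{sj}}(x)$. (B) (Here $\mathbb{F}=\mathbb{F}_{q^2}$.) $\mathcal{C}$ is Hermitian self-orthogonal if and only if for all $1\le r\le s\le t$: $h_r^{[q]}(x)\mid \overline{g_s}(x)\sum_{j=1}^{l}k_{rj}^{[q]}(x)\overline{k_{sj}}(x)$. (C) (Here $\mathbb{F}=\mathbb{F}_q$, $l$ even, $\omega=l/2$.) $\mathcal{C}$ is symplectic self-orthogonal if and only if for all $1\le r\le s\le t$: $h_r(x)\mid \overline{g_s}(x)\sum_{j=1}^{\omega}\big(k_{rj}(x)\overline{k_{s(\omega+j)}}(x)-k_{r(\omega+j)}(x)\overline{k_{sj}}(x)\big)$.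
   Context: $q$ is a prime power, $\mathbb{F}$ is the base field indicated in each case, $\mathcal{R}=\mathbb{F}[x]/(x^m-1)$, and elements of $\mathcal{R}$ are identified with their representatives of degree $<m$. For $k(x)=\sum_{i=0}^{m-1}k_ix^i\in\mathcal{R}$: $[k(x)]=(k_0,\dots,k_{m-1})\in\mathbb{F}^m$; $\overline{k}(x)=k(x^{-1})\bmod (x^m-1)=k_0+k_{m-1}x+\dots+k_1x^{m-1}$; $k^{[q]}(x)=\sum_i k_i^qx^i$. For a divisor $h$ of $x^m-1$ and $a\in\mathcal{R}$, ''$h\mid a$'' means $h$ divides the representative of $a$ (well defined since $h\mid x^m-1$). The QC code of length $ml$ generated by tuples $(u_{i1},\dots,u_{il})\in\mathcal{R}^l$, $1\le i\le t$, is the set $\{([\sum_i r_iu_{i1}],\dots,[\sum_i r_iu_{il}]) : r_1,\dots,r_t\in\mathcal{R}\}\subseteq\mathbb{F}^{ml}$, vectors being concatenations of blocks of length $m$. Inner products on $\mathbb{F}^N$: Euclidean $\langle u,v\rangle_E=\sum u_iv_i$; Hermitian (over $\mathbb{F}_{q^2}$) $\langle u,v\rangle_H=\sum u_i^qv_i$; symplectic (for $N=2n$) $\langle u,v\rangle_S=\sum_{i=1}^n(u_iv_{n+i}-u_{n+i}v_i)$. A code $\mathcal{C}$ is self-orthogonal w.r.t. an inner product if $\mathcal{C}\subseteq\mathcal{C}^{\perp}$, the dual being $\{u:\langle u,c\rangle=0\ \forall c\in\mathcal{C}\}$. *)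

(* Defs.v *)
From HB Require Import structures.
From mathcomp Require Import all_boot all_order all_algebra.
Set Implicit Arguments. Unset Strict Implicit. Unset Printing Implicit Defensive.
Import GRing.Theory.
Local Open Scope ring_scope.

(* Ring R = F[x]/(x^m - 1); elements are represented by polynomials, and the
   canonical representative (degree < m) of p is p %% (x^m - 1). *)
Definition xm1 (F : fieldType) (m : nat) : {poly F} := 'X^m - 1.
Definition rrep (F : fieldType) (m : nat) (p : {poly F}) : {poly F} := p %% xm1 F m.

(* \overline{k}(x) = k(x^{-1}) mod (x^m - 1): coefficient i is k_{(m-i) mod m} *)
Definition rbar (F : fieldType) (m : nat) (p : {poly F}) : {poly F} :=
  \poly_(i < m) (rrep m p)`_((m - i) %% m)%N.

Definition rfrob (F : fieldType) (q : nat) (p : {poly F}) : {poly F} :=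
  map_poly (fun a : F => a ^+ q) p.

(* ([a_0], ..., [a_{l-1}]) in F^{ml}: concatenation of blocks of length m;
   position k of the vector is coefficient (k mod m) of block (k div m). *)
Definition qc_vec (F : fieldType) (m l : nat) (a : nat -> {poly F}) : 'rV[F]_(m * l) :=
  \row_(k < m * l) (rrep m (a (k %/ m)%N))`_(k %% m)%N.

Definition qc_code (F : fieldType) (m l t : nat) (u : nat -> nat -> {poly F})
  : 'rV[F]_(m * l) -> Prop :=
  fun c => exists r : nat -> {poly F},
    c = qc_vec m l (fun j => \sum_(i < t) r i * u i j).

Definition ipE (F : fieldType) (N : nat) (u v : 'rV[F]_N) : F :=
  \sum_(i < N) u 0 i * v 0 i.

Definition ipH (F : fieldType) (q N : nat) (u v : 'rV[F]_N) : F :=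
  \sum_(i < N) (u 0 i) ^+ q * v 0 i.

Definition vcoord (F : fieldType) (N : nat) (u : 'rV[F]_N) (k : nat) : F :=
  nth 0 [seq u 0 i | i <- enum 'I_N] k.

Definition ipS (F : fieldType) (N : nat) (u v : 'rV[F]_N) : F :=
  \sum_(i < N./2) (vcoord u i * vcoord v (N./2 + i)
                   - vcoord u (N./2 + i) * vcoord v i).

Definition dual (F : fieldType) (N : nat) (ip : 'rV[F]_N -> 'rV[F]_N -> F)
  (C : 'rV[F]_N -> Prop) : 'rV[F]_N -> Prop :=
  fun u => forall c, C c -> ip u c = 0.

Definition self_orthogonal (F : fieldType) (N : nat)
  (ip : 'rV[F]_N -> 'rV[F]_N -> F) (C : 'rV[F]_N -> Prop) : Prop :=
  forall c, C c -> dual ip C c.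

Arguments rrep {F} m p.
Arguments rbar {F} m p.
Arguments rfrob {F} q p.
Arguments qc_vec {F} m l a.
Arguments qc_code {F} m l t u _.

(* Main.v *)
(** Modulo [x^m - 1] the substitution [x |-> x^-1] is an involution, and the
    constant coefficient of [a * bar b] is the dot product of the coefficient
    vectors of [a] and [b]. Hence each of the three inner products is the
    constant coefficient of a form [phi(a) *m M *m (bar b)^T] with values in
    [F[x]/(x^m - 1)], where [phi] is the identity or the [q]-th power map, and
    [M] is the identity matrix or the standard symplectic matrix. Constant
    coefficients detect zero once arbitrary polynomial multiples are allowed, so
    the code is self-orthogonal iff the Gram matrix of its generators vanishes
    modulo [x^m - 1]. Since [M] is Hermitian or skew, so is the Gram matrix, and
    its upper triangle suffices. Its [(r, s)] entry has the factor [phi(g_r)];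
    cancelling it from [x^m - 1 = phi(g_r) phi(h_r)] leaves the divisibility by
    [phi(h_r)]. *)

Require Import Defs.
From HB Require Import structures.
From mathcomp Require Import all_boot all_order all_algebra all_field.
From mathcomp Require Import zify.
Set Implicit Arguments. Unset Strict Implicit. Unset Printing Implicit Defensive.
Import GRing.Theory.
Local Open Scope ring_scope.

Lemma size_xm1 (F : fieldType) m : (0 < m)%N -> size (xm1 F m) = m.+1.
Proof. exact: size_XnsubC. Qed.

Lemma xm1_neq0 (F : fieldType) m : (0 < m)%N -> xm1 F m != 0.
Proof. by move=> m_gt0; rewrite -size_poly_gt0 size_xm1. Qed.

Lemma map_xm1 (F F' : fieldType) (phi : {rmorphism F -> F'}) m :
  map_poly phi (xm1 F m) = xm1 F' m.
Proof. by rewrite rmorphB rmorph1 /= map_polyXn. Qed.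

Lemma map_rrep (F F' : fieldType) (phi : {rmorphism F -> F'}) m p :
  map_poly phi (rrep m p) = rrep m (map_poly phi p).
Proof. by rewrite /rrep map_modp map_xm1. Qed.

Section Reduction.

Variables (F : fieldType) (m : nat).
Hypothesis m_gt0 : (0 < m)%N.
Implicit Types p q d : {poly F}.

Fact rrep_is_linear : linear (@rrep F m).
Proof. by move=> c p q; rewrite /rrep modpD modpZl. Qed.

HB.instance Definition _ :=
  GRing.isLinear.Build F {poly F} {poly F} *:%R (@rrep F m) rrep_is_linear.

Lemma rrep_id p : rrep m (rrep m p) = rrep m p.
Proof. exact: modp_id. Qed.

Lemma rrepMl p q : rrep m (rrep m p * q) = rrep m (p * q).
Proof. by rewrite /rrep mulrC modp_mul mulrC. Qed.

Lemma eq_rrepM p p' q q' :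
  rrep m p = rrep m p' -> rrep m q = rrep m q' ->
  rrep m (p * q) = rrep m (p' * q').
Proof.
move=> pp' qq'; rewrite -rrepMl pp' rrepMl ![p' * _]mulrC.
by rewrite -rrepMl qq' rrepMl.
Qed.

Lemma eq_rrepX p q n : rrep m p = rrep m q -> rrep m (p ^+ n) = rrep m (q ^+ n).
Proof. by move=> pq; elim: n => // n IHn; rewrite !exprS; apply: eq_rrepM. Qed.

Lemma rrep_eq0 p : (rrep m p == 0) = (xm1 F m %| p).
Proof. by []. Qed.

Lemma dvdp_rrep d p : d %| xm1 F m -> (d %| rrep m p) = (d %| p).
Proof. by move=> dm; rewrite /rrep -dvdp_mod. Qed.

Lemma eq_rrep_dvdp d p q :
  d %| xm1 F m -> rrep m p = rrep m q -> (d %| p) = (d %| q).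
Proof. by move=> dm pq; rewrite -(dvdp_rrep p dm) pq dvdp_rrep. Qed.

Lemma size_rrep p : (size (rrep m p) <= m)%N.
Proof. by rewrite -ltnS -(size_xm1 F m_gt0) ltn_modp xm1_neq0. Qed.

Lemma rrep_sumX p : rrep m p = \sum_(i < m) (rrep m p)`_i *: 'X^i.
Proof.
rewrite -(poly_def m (fun i => (rrep m p)`_i)); apply/polyP => i.
rewrite coef_poly; case: ltnP => // mi.
by rewrite nth_default // (leq_trans (size_rrep p)).
Qed.

Lemma rrepXn n : rrep m 'X^n = 'X^(n %% m) :> {poly F}.
Proof.
have rrepXm : rrep m 'X^m = rrep m 1 :> {poly F}.
  by apply/eqP; rewrite -subr_eq0 -raddfB; exact: dvdpp.
rewrite {1}(divn_eq n m) mulnC exprD exprM.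
rewrite (eq_rrepM (eq_rrepX (n %/ m) rrepXm) erefl) expr1n mul1r.
by rewrite /rrep modp_small // size_polyXn size_xm1 // ltnS ltn_pmod.
Qed.

Lemma coef0_rrepXn n : (rrep m 'X^n : {poly F})`_0 = (m %| n)%:R.
Proof. by rewrite rrepXn coefXn eq_sym. Qed.

End Reduction.

(* ['X^(m.-1)] represents the inverse of ['X] modulo [x^m - 1]. *)
Definition xinv (F : fieldType) m (p : {poly F}) : {poly F} := p \Po 'X^(m.-1).

Section Inversion.

Variables (F : fieldType) (m : nat).
Hypothesis m_gt0 : (0 < m)%N.
Implicit Types p q : {poly F}.

HB.instance Definition _ :=
  GRing.LRMorphism.copy (@xinv F m) (comp_poly 'X^(m.-1)).

Lemma xinvXn n : xinv m 'X^n = 'X^(n * m.-1) :> {poly F}.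
Proof. by rewrite /xinv comp_Xn_poly -exprM mulnC. Qed.

Lemma dvdn_addn_mul_pred i j : (m %| i + j * m.-1)%N = (i == j %[mod m]).
Proof.
rewrite -(eqn_modDr (j * m.-1)) -[in RHS]mulnS prednK //.
by rewrite modnMl.
Qed.

Lemma rrepXn_xinvXn i j :
  (m %| i + j)%N -> rrep m 'X^i = rrep m (xinv m 'X^j) :> {poly F}.
Proof.
move=> m_ij; rewrite xinvXn !rrepXn //; congr 'X^_; apply/eqP.
by rewrite eq_sym -dvdn_addn_mul_pred -mulnDl addnC dvdn_mulr.
Qed.

Lemma dvdp_xinv p : xm1 F m %| p -> xm1 F m %| xinv m p.
Proof.
case/dvdpP => q ->; rewrite rmorphM /= dvdp_mull // rmorphB rmorph1 /= xinvXn.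
by rewrite -rrep_eq0 raddfB /= -(expr0 'X) !rrepXn // mod0n mulnC modnMl subrr.
Qed.

Lemma eq_rrep_xinv p q :
  rrep m p = rrep m q -> rrep m (xinv m p) = rrep m (xinv m q).
Proof.
move/eqP; rewrite -subr_eq0 -raddfB rrep_eq0 => /dvdp_xinv.
by rewrite raddfB -rrep_eq0 raddfB subr_eq0 => /eqP.
Qed.

Lemma rrep_xinvK p : rrep m (xinv m (xinv m p)) = rrep m p.
Proof.
rewrite -[p]coefK poly_def !raddf_sum; apply: eq_bigr => i _ /=.
rewrite !linearZ /=; congr (_ *: _).
rewrite xinvXn; apply/esym/rrepXn_xinvXn.
by rewrite -mulnS prednK // dvdn_mull.
Qed.

Lemma coef_rrep p n : (rrep m p)`_(n %% m) = (rrep m (p * xinv m 'X^n))`_0.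
Proof.
rewrite -rrepMl [in RHS](rrep_sumX m_gt0 p) mulr_suml raddf_sum coef_sum /=.
have coef0_term (i : 'I_m) : (rrep m ((rrep m p)`_i *: 'X^i * xinv m 'X^n))`_0 =
    (rrep m p)`_i *+ (i == n %% m :> nat)%N.
  rewrite -scalerAl linearZ coefZ /= xinvXn -exprD coef0_rrepXn //.
  by rewrite dvdn_addn_mul_pred (modn_small (ltn_ord i)) mulr_natr.
rewrite (eq_bigr _ (fun i _ => coef0_term i)).
rewrite (bigD1 (Ordinal (ltn_pmod n m_gt0))) //=.
by rewrite eqxx big1 ?addr0 // => i; rewrite -val_eqE => /negPf /= ->.
Qed.

Lemma coef0_rrepM_xinv p q :
  (rrep m (p * xinv m q))`_0 = \sum_(i < m) (rrep m p)`_i * (rrep m q)`_i.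
Proof.
rewrite (eq_rrepM (erefl (rrep m p)) (eq_rrep_xinv (esym (rrep_id m q)))).
rewrite [in LHS](rrep_sumX m_gt0 q) raddf_sum mulr_sumr raddf_sum coef_sum /=.
apply: eq_bigr => i _; rewrite linearZ -scalerAr linearZ coefZ /= -coef_rrep.
by rewrite modn_small // mulrC.
Qed.

Lemma coef0_rrep_xinv p : (rrep m (xinv m p))`_0 = (rrep m p)`_0.
Proof.
rewrite -[xinv m p]mul1r coef0_rrepM_xinv -[in RHS](mulr1 p).
rewrite -[X in p * X](rmorph1 (xinv m)).
by rewrite coef0_rrepM_xinv; apply: eq_bigr => i _; rewrite mulrC.
Qed.

Lemma rbarE p : rbar m p = rrep m (xinv m p).
Proof.
apply/polyP => i; rewrite coef_poly; case: ltnP => [im|mi]; last first.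
  by rewrite nth_default // (leq_trans (size_rrep m_gt0 _)).
rewrite -[in RHS](modn_small im) !coef_rrep -rmorphM coef0_rrep_xinv.
congr (polyseq _)`_0; apply: eq_rrepM => //; apply/esym/rrepXn_xinvXn.
by rewrite subnKC // ltnW.
Qed.

Lemma dvdp_xm1_coef0 p :
  (forall q, (rrep m (xinv m q * p))`_0 = 0) -> xm1 F m %| p.
Proof.
move=> coef0_eq0; rewrite -rrep_eq0; apply/eqP/polyP => i; rewrite coef0.
have [im|mi] := ltnP i m; first by rewrite -(modn_small im) coef_rrep mulrC.
by rewrite nth_default // (leq_trans (size_rrep m_gt0 _)).
Qed.

End Inversion.

Lemma map_xinv (F F' : fieldType) (phi : {rmorphism F -> F'}) m p :
  map_poly phi (xinv m p) = xinv m (map_poly phi p).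
Proof. by rewrite /xinv map_comp_poly map_polyXn. Qed.

Lemma dvdp_sum (R : idomainType) (d : {poly R}) I (r : seq I) (P : pred I) G :
  (forall i, P i -> d %| G i) -> d %| \sum_(i <- r | P i) G i.
Proof. by move=> d_dvd; elim/big_ind: _ => // p q; exact: dvdp_add. Qed.

Section Gram.

Variables (F : fieldType) (m l : nat) (phi : {rmorphism F -> F}) (M : 'M[F]_l).
Hypothesis m_gt0 : (0 < m)%N.

Local Notation phiP := (map_poly phi).
Local Notation conj_poly := (xinv m \o phiP).

Definition gram t t' (U : 'M[{poly F}]_(t, l)) (V : 'M[{poly F}]_(t', l)) :
    'M[{poly F}]_(t, t') :=
  map_mx phiP U *m map_mx polyC M *m map_mx (xinv m) V^T.

Lemma gram_mulmx s s' t t' (A : 'M_(s, t)) (B : 'M_(s', t'))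
    (U : 'M[{poly F}]_(t, l)) (V : 'M[{poly F}]_(t', l)) :
  gram (A *m U) (B *m V) = map_mx phiP A *m gram U V *m map_mx (xinv m) B^T.
Proof. by rewrite /gram trmx_mul !map_mxM !mulmxA. Qed.

Lemma gram_row t t' (U : 'M[{poly F}]_(t, l)) (V : 'M[{poly F}]_(t', l)) i j :
  gram U V i j = gram (row i U) (row j V) 0 0.
Proof.
rewrite (rowE i U) (rowE j V) gram_mulmx map_delta_mx -rowE.
by rewrite trmx_delta map_delta_mx -colE !mxE.
Qed.

Lemma gramZ t t' c d (U : 'M[{poly F}]_(t, l)) (V : 'M[{poly F}]_(t', l)) :
  gram (c *: U) (d *: V) = phiP c * xinv m d *: gram U V.
Proof.
by rewrite /gram linearZ !map_mxZ -!scalemxAl -scalemxAr scalerA.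
Qed.

Lemma eq_rrep_graml t t' (U U' : 'M[{poly F}]_(t, l))
    (V : 'M[{poly F}]_(t', l)) i j :
  (forall i' j', rrep m (U i' j') = rrep m (U' i' j')) ->
  rrep m (gram U V i j) = rrep m (gram U' V i j).
Proof.
move=> UU'; rewrite !mxE !raddf_sum; apply: eq_bigr => k _.
apply: eq_rrepM => //; rewrite !mxE !raddf_sum; apply: eq_bigr => k' _.
by apply: eq_rrepM => //; rewrite !mxE -!map_rrep UU'.
Qed.

Definition qc_form (a b : nat -> {poly F}) : {poly F} :=
  gram (\row_j a j) (\row_j b j) 0 0.

Lemma dvdp_qc_form_mulr g g' a b p :
  g %| xm1 F m -> rrep m p = rrep m (qc_form a b) ->
  (xm1 F m %| qc_form (fun j => a j * g) (fun j => b j * g')) =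
  (phiP (xm1 F m %/ g) %| rrep m (rbar m g' * p)).
Proof.
move=> g_dvd pE; have gE := divpK g_dvd.
have g_neq0 : phiP g != 0 by rewrite map_poly_eq0 (dvdpN0 g_dvd) // xm1_neq0.
have h_dvd : phiP (xm1 F m %/ g) %| xm1 F m.
  by rewrite -{2}(map_xm1 phi) dvdp_map -{2}gE dvdp_mulr.
have rowZ c (q : {poly F}) : \row_(j < l) (c j * q) = q *: \row_j c j.
  by apply/rowP => j; rewrite !mxE mulrC.
rewrite /qc_form !rowZ gramZ mxE -mulrA mulrC -{1}(map_xm1 phi) -{1}gE rmorphM.
rewrite dvdp_mul2r // dvdp_rrep //; apply/esym/(eq_rrep_dvdp h_dvd).
by apply: eq_rrepM pE; rewrite rbarE // rrep_id.
Qed.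

Variable ip : 'rV[F]_(m * l) -> 'rV[F]_(m * l) -> F.
Hypothesis ip_qc_vec : forall a b : nat -> {poly F},
  ip (qc_vec m l a) (qc_vec m l b) = (rrep m (qc_form a b))`_0.

Definition generator_mx t (u : nat -> nat -> {poly F}) : 'M[{poly F}]_(t, l) :=
  \matrix_(i, j) u i j.

Lemma self_orthogonal_gram t (u : nat -> nat -> {poly F}) :
  self_orthogonal ip (qc_code m l t u) <->
  forall i i', xm1 F m %| gram (generator_mx t u) (generator_mx t u) i i'.
Proof.
set U := generator_mx t u.
have row_comb (r : nat -> {poly F}) :
    \row_(j < l) (\sum_(i < t) r i * u i j) = (\row_(i < t) r i) *m U.
  by apply/rowP => j; rewrite !mxE; apply: eq_bigr => i _; rewrite !mxE.
split=> [so i i' | dvd_gram c [r ->] c' [r' ->]]; last first.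
  rewrite ip_qc_vec /qc_form !row_comb gram_mulmx; set G := mulmx _ _.
  suff: xm1 F m %| G 0 0 by rewrite -rrep_eq0 => /eqP ->; rewrite coef0.
  rewrite mxE dvdp_sum // => j _; rewrite dvdp_mulr // mxE dvdp_sum // => i _.
  by rewrite dvdp_mull.
apply: dvdp_xm1_coef0 => // p.
pose r n : {poly F} := (n == i :> nat)%:R; pose r' n := (n == i' :> nat)%:R * p.
have := so _ (ex_intro _ r erefl) _ (ex_intro _ r' erefl).
rewrite ip_qc_vec /qc_form !row_comb.
have -> : \row_(i < t) r i = delta_mx 0 i by apply/rowP => j; rewrite !mxE.
have -> : \row_(i < t) r' i = p *: delta_mx 0 i'.
  by apply/rowP => j; rewrite !mxE mulrC.
rewrite -scalemxAl -!rowE -[row i U]scale1r gramZ rmorph1 mul1r.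
by rewrite mxE -gram_row.
Qed.

Hypothesis phiK : involutive phi.
Variable eps : bool.
Hypothesis M_herm : M \is hermitianmx l eps phi.

(* [xinv m] is an involution only modulo [x^m - 1], so [V] comes back as its
   double image under [xinv m] and not as itself. *)
Lemma tr_gram t t' (U : 'M[{poly F}]_(t, l)) (V : 'M[{poly F}]_(t', l)) :
  map_mx conj_poly (gram U V)^T =
  (-1) ^+ eps *: gram (map_mx (xinv m \o xinv m) V) U.
Proof.
rewrite /gram scalemxAl scalemxAr.
have conjK p : phiP (phiP p) = p by apply/polyP => i; rewrite !coef_map /= phiK.
have -> : map_mx (xinv m) U^T = map_mx conj_poly (map_mx phiP U)^T.
  by apply/matrixP => i j; rewrite !mxE /= conjK.
have -> : map_mx phiP (map_mx (xinv m \o xinv m) V) =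
          map_mx conj_poly (map_mx (xinv m) V^T)^T.
  by apply/matrixP => i j; rewrite !mxE /= !map_xinv.
have /is_hermitianmxP Meps := M_herm.
have -> : (-1) ^+ eps *: map_mx polyC M = map_mx conj_poly (map_mx polyC M)^T.
  apply/matrixP => i j; rewrite [in LHS]Meps !mxE /= map_polyC /xinv comp_polyC.
  by rewrite polyCM rmorph_sign mulrA -signr_addb addbb mul1r.
by rewrite -!map_mxM -!trmx_mul mulmxA.
Qed.

Lemma dvdp_gramC t t' (U : 'M[{poly F}]_(t, l)) (V : 'M[{poly F}]_(t', l)) i j :
  xm1 F m %| gram U V i j -> xm1 F m %| gram V U j i.
Proof.
rewrite -(dvdp_map phi) map_xm1 => /(dvdp_xinv m_gt0).
have -> : xinv m (phiP (gram U V i j)) = map_mx conj_poly (gram U V)^T j i.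
  by rewrite [RHS]mxE [in RHS]mxE.
rewrite tr_gram [X in _ %| X]mxE mulr_sign (fun_if (dvdp _)) dvdpNr if_same.
rewrite -!rrep_eq0 (@eq_rrep_graml _ _ _ V) // => i' j'.
by rewrite mxE /= rrep_xinvK.
Qed.

Lemma qc_self_orthogonalP t (g : nat -> {poly F})
    (k form : nat -> nat -> {poly F}) :
  (forall i, (i < t)%N -> g i %| xm1 F m) ->
  (forall r s, rrep m (form r s) = rrep m (qc_form (k r) (k s))) ->
  self_orthogonal ip (qc_code m l t (fun i j => k i j * g i)) <->
  (forall r s, (r <= s)%N -> (s < t)%N ->
     phiP (xm1 F m %/ g r) %| rrep m (rbar m (g s) * form r s)).
Proof.
move=> g_dvd formE; rewrite self_orthogonal_gram; set U := generator_mx t _.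
have gramE (i i' : 'I_t) : (xm1 F m %| gram U U i i') =
    (phiP (xm1 F m %/ g i) %| rrep m (rbar m (g i') * form i i')).
  rewrite -(dvdp_qc_form_mulr _ (g_dvd i _) (formE i i')) // gram_row /qc_form.
  by congr (_ %| gram _ _ 0 0); apply/rowP => j; rewrite !mxE.
split=> [dvd_gram r s rs st | dvd_form i i'].
  by rewrite -(gramE (Ordinal (leq_ltn_trans rs st)) (Ordinal st)).
have [ii' | /ltnW i'i] := leqP i i'; first by rewrite gramE dvd_form.
by apply: dvdp_gramC; rewrite gramE dvd_form.
Qed.

End Gram.

Lemma big_ord_divn_modn (R : Type) (idx : R) (op : Monoid.law idx) m n
    (G : nat -> nat -> R) :
  (0 < m)%N ->
  \big[op/idx]_(k < m * n) G (k %/ m)%N (k %% m)%N =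
  \big[op/idx]_(j < n) \big[op/idx]_(i < m) G j i.
Proof.
move=> m_gt0; elim: n => [|n IHn]; first by rewrite muln0 !big_ord0.
rewrite mulnSr big_split_ord /= IHn big_ord_recr /=; congr (op _ _).
apply: eq_bigr => i _; rewrite mulnC divnMDl // divn_small // addn0.
by rewrite modnMDl modn_small.
Qed.

Section ConjDot.

Variables (F : fieldType) (m : nat) (phi : {rmorphism F -> F}).
Hypothesis m_gt0 : (0 < m)%N.
Implicit Types a b : nat -> {poly F}.

Definition conj_dot n a b : {poly F} :=
  \sum_(j < n) map_poly phi (a j) * xinv m (b j).

Lemma coef0_conj_dot n a b :
  (rrep m (conj_dot n a b))`_0 =
  \sum_(k < m * n) phi (qc_vec m n a 0 k) * qc_vec m n b 0 k.
Proof.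
under eq_bigr => k _ do rewrite !mxE.
rewrite (big_ord_divn_modn _ n
  (fun j i => phi (rrep m (a j))`_i * (rrep m (b j))`_i)) //.
rewrite raddf_sum coef_sum; apply: eq_bigr => j _ /=.
rewrite coef0_rrepM_xinv //; apply: eq_bigr => i _.
by rewrite -coef_map /= map_rrep.
Qed.

Lemma rrep_conj_dot n a b :
  rrep m (\sum_(j < n) map_poly phi (rrep m (a j)) * rbar m (b j)) =
  rrep m (conj_dot n a b).
Proof.
rewrite !raddf_sum; apply: eq_bigr => j _; apply: eq_rrepM.
  by rewrite map_rrep rrep_id.
by rewrite rbarE // rrep_id.
Qed.

Lemma qc_form1 l a b : qc_form m phi (1%:M : 'M_l) a b = conj_dot l a b.
Proof.
rewrite /qc_form /gram map_mx1 mulmx1 mxE.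
by apply: eq_bigr => j _; rewrite !mxE.
Qed.

Lemma mx1_hermitian n : (1%:M : 'M[F]_n) \is hermitianmx n false phi.
Proof. by apply/is_hermitianmxP; rewrite scale1r trmx1 map_mx1. Qed.

Definition symplectic_mx n : 'M[F]_(n + n) := block_mx 0 1%:M (- 1%:M) 0.

Lemma symplectic_mx_skew n : symplectic_mx n \is hermitianmx _ true phi.
Proof.
apply/is_hermitianmxP; rewrite tr_block_mx map_block_mx scaleN1r opp_block_mx.
by rewrite !trmx0 linearN /= trmx1 !map_mx0 map_mxN map_mx1 !oppr0 opprK.
Qed.

Lemma qc_form_symplectic n a b :
  qc_form m phi (symplectic_mx n) a b =
  conj_dot n a (fun j => b (n + j)%N) - conj_dot n (fun j => a (n + j)%N) b.
Proof.
have split_row (c : nat -> {poly F}) :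
    \row_(j < n + n) c j = row_mx (\row_(j < n) c j) (\row_(j < n) c (n + j)%N).
  by rewrite -[LHS]hsubmxK; congr row_mx; apply/rowP => j; rewrite !mxE.
rewrite -!qc_form1 /qc_form !split_row /gram map_row_mx map_block_mx tr_row_mx.
rewrite map_col_mx mul_row_block mul_row_col !map_mx0 map_mxN !map_mx1.
by rewrite !mulmx0 mulmxN !mulmx1 add0r addr0 mulNmx addrC !mxE.
Qed.

End ConjDot.

Lemma vcoord_qc_vec (F : fieldType) m l (a : nat -> {poly F}) k :
  (k < m * l)%N ->
  vcoord (qc_vec m l a) k = (rrep m (a (k %/ m)%N))`_(k %% m)%N.
Proof.
move=> k_lt; rewrite /vcoord (nth_map (Ordinal k_lt)) ?size_enum_ord //.
by rewrite mxE nth_enum_ord.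
Qed.

Lemma ipS_qc_vec (F : fieldType) m n (a b : nat -> {poly F}) :
  (0 < m)%N ->
  ipS (qc_vec m (n + n) a) (qc_vec m (n + n) b) =
  \sum_(k < m * n) qc_vec m n a 0 k * qc_vec m n (fun j => b (n + j)%N) 0 k -
  \sum_(k < m * n) qc_vec m n (fun j => a (n + j)%N) 0 k * qc_vec m n b 0 k.
Proof.
move=> m_gt0; rewrite /ipS -sumrB.
have -> : ((m * (n + n))./2 = m * n)%N by rewrite addnn -doubleMr doubleK.
apply: eq_bigr => -[k k_lt] _ /=; rewrite !vcoord_qc_vec; [|lia..].
by rewrite !mxE /= [(m * n)%N]mulnC divnMDl // modnMDl.
Qed.

Lemma pchar_nat_card (F : finFieldType) : [pchar F].-nat #|F|.
Proof.
have [p _ charFp] := finPcharP F.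
rewrite (eq_pnat _ (pcharf_eq charFp)) -cardsT.
exact: (pprimeChar_pgroup charFp).
Qed.

Definition frobenius_conj (F : finFieldType) q of #|F| = (q ^ 2)%N :=
  fun x : F => x ^+ q.

Section FrobeniusConj.

Variables (F : finFieldType) (q : nat).
Hypothesis cardF : #|F| = (q ^ 2)%N.

Let pchar_q : [pchar F].-nat q.
Proof. by have := pchar_nat_card F; rewrite cardF pnatX orbF. Qed.

Fact frobenius_conj_is_zmod_morphism : zmod_morphism (frobenius_conj cardF).
Proof. by move=> x y; rewrite /frobenius_conj exprDn_pchar ?exprNn_pchar. Qed.

Fact frobenius_conj_is_monoid_morphism : monoid_morphism (frobenius_conj cardF).
Proof. by split=> [|x y]; rewrite /frobenius_conj ?expr1n ?exprMn. Qed.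

Fact frobenius_conjK : involutive (frobenius_conj cardF).
Proof. by move=> x; rewrite /frobenius_conj -exprM mulnn -cardF expf_card. Qed.

HB.instance Definition _ :=
  GRing.isZmodMorphism.Build F F (frobenius_conj cardF)
    frobenius_conj_is_zmod_morphism.
HB.instance Definition _ :=
  GRing.isMonoidMorphism.Build F F (frobenius_conj cardF)
    frobenius_conj_is_monoid_morphism.

End FrobeniusConj.

Section SelfOrthogonality.

Variables (F : fieldType) (m t : nat).
Variables (g : nat -> {poly F}) (k : nat -> nat -> {poly F}).
Hypothesis m_gt0 : (0 < m)%N.
Hypothesis g_dvd : forall i, (i < t)%N -> g i %| xm1 F m.

Lemma sesquilinear_self_orthogonalP l (phi : {rmorphism F -> F}) :
  involutive phi ->
  self_orthogonal (fun u v : 'rV_(m * l) => \sum_i phi (u 0 i) * v 0 i)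
    (qc_code m l t (fun i j => k i j * g i)) <->
  (forall r s, (r <= s)%N -> (s < t)%N ->
     map_poly phi (xm1 F m %/ g r) %|
       rrep m (rbar m (g s) *
               \sum_(j < l) map_poly phi (rrep m (k r j)) * rbar m (k s j))).
Proof.
move=> phiK.
apply: (qc_self_orthogonalP m_gt0 _ phiK (mx1_hermitian phi l)) => //.
  by move=> a b; rewrite qc_form1 coef0_conj_dot.
by move=> r s; rewrite qc_form1 rrep_conj_dot.
Qed.

Lemma euclidean_self_orthogonalP l :
  self_orthogonal (@ipE F (m * l)) (qc_code m l t (fun i j => k i j * g i)) <->
  (forall r s, (r <= s)%N -> (s < t)%N ->
     xm1 F m %/ g r %|
       rrep m (rbar m (g s) * \sum_(j < l) rrep m (k r j) * rbar m (k s j))).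
Proof.
rewrite (@sesquilinear_self_orthogonalP l idfun) //.
have form_idfun r s :
    \sum_(j < l) map_poly idfun (rrep m (k r j)) * rbar m (k s j) =
    \sum_(j < l) rrep m (k r j) * rbar m (k s j).
  by apply: eq_bigr => j _; rewrite map_poly_id.
by split=> dvd r s rs st; have := dvd r s rs st; rewrite form_idfun map_poly_id.
Qed.

Lemma symplectic_self_orthogonalP n :
  self_orthogonal (@ipS F (m * (n + n)))
    (qc_code m (n + n) t (fun i j => k i j * g i)) <->
  (forall r s, (r <= s)%N -> (s < t)%N ->
     xm1 F m %/ g r %|
       rrep m (rbar m (g s) *
               \sum_(j < n) (rrep m (k r j) * rbar m (k s (n + j)%N)
                             - rrep m (k r (n + j)%N) * rbar m (k s j)))).
Proof.
pose form r s : {poly F} :=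
  \sum_(j < n) (rrep m (k r j) * rbar m (k s (n + j)%N)
                - rrep m (k r (n + j)%N) * rbar m (k s j)).
have form_symplectic r s :
    rrep m (form r s) =
    rrep m (qc_form m idfun (symplectic_mx F n) (k r) (k s)).
  rewrite qc_form_symplectic // raddfB /= -!rrep_conj_dot // -raddfB -sumrB.
  by congr rrep; apply: eq_bigr => j _; rewrite !map_poly_id.
rewrite (qc_self_orthogonalP m_gt0 _ _ (symplectic_mx_skew idfun n)
  g_dvd form_symplectic) //.
  by split=> dvd r s rs st; have := dvd r s rs st; rewrite map_poly_id.
move=> a b; rewrite qc_form_symplectic ipS_qc_vec // raddfB coefB /=.
by rewrite !coef0_conj_dot.
Qed.

End SelfOrthogonality.

Lemma hermitian_self_orthogonalP (F : finFieldType) q m l t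
    (g : nat -> {poly F}) (k : nat -> nat -> {poly F}) :
  #|F| = (q ^ 2)%N -> (0 < m)%N -> (forall i, (i < t)%N -> g i %| xm1 F m) ->
  self_orthogonal (@ipH F q (m * l))
    (qc_code m l t (fun i j => k i j * g i)) <->
  (forall r s, (r <= s)%N -> (s < t)%N ->
     rfrob q (xm1 F m %/ g r) %|
       rrep m (rbar m (g s) *
               \sum_(j < l) rfrob q (rrep m (k r j)) * rbar m (k s j))).
Proof.
move=> cardF m_gt0 g_dvd.
exact: (sesquilinear_self_orthogonalP k m_gt0 g_dvd l (frobenius_conjK cardF)).
Qed.

Theorem mainTheorem2 (m l t : nat) (Hm : (0 < m)%N) (Hl : (0 < l)%N) (Ht : (0 < t)%N) :
  (* (A) Euclidean, F = F_q *)
  (forall (F : finFieldType) (g : nat -> {poly F}) (k : nat -> nat -> {poly F}),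
     let h := fun i => xm1 F m %/ g i in
     (forall i, (i < t)%N -> g i \is monic) ->
     (forall i, (i < t)%N -> g i %| xm1 F m) ->
     (forall i, (i < t)%N ->
        coprimep (\big[@gcdp F/0]_(j < l) rrep m (k i j)) (h i)) ->
     (self_orthogonal (@ipE F (m * l))
        (qc_code m l t (fun i j => k i j * g i))
      <->
      (forall r s, (r <= s)%N -> (s < t)%N ->
         h r %| rrep m (rbar m (g s) *
                        \sum_(j < l) rrep m (k r j) * rbar m (k s j))))) /\
  (* (B) Hermitian, F = F_{q^2} *)
  (forall (q : nat) (F : finFieldType) (g : nat -> {poly F}) (k : nat -> nat -> {poly F}),
     #|F| = (q ^ 2)%N ->
     let h := fun i => xm1 F m %/ g i in
     (forall i, (i < t)%N -> g i \is monic) ->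
     (forall i, (i < t)%N -> g i %| xm1 F m) ->
     (forall i, (i < t)%N ->
        coprimep (\big[@gcdp F/0]_(j < l) rrep m (k i j)) (h i)) ->
     (self_orthogonal (@ipH F q (m * l))
        (qc_code m l t (fun i j => k i j * g i))
      <->
      (forall r s, (r <= s)%N -> (s < t)%N ->
         rfrob q (h r) %| rrep m (rbar m (g s) *
                        \sum_(j < l) rfrob q (rrep m (k r j)) * rbar m (k s j))))) /\
  (* (C) symplectic, F = F_q, l even, omega = l/2 *)
  (~~ odd l ->
   forall (F : finFieldType) (g : nat -> {poly F}) (k : nat -> nat -> {poly F}),
     let h := fun i => xm1 F m %/ g i in
     (forall i, (i < t)%N -> g i \is monic) ->
     (forall i, (i < t)%N -> g i %| xm1 F m) ->
     (forall i, (i < t)%N ->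
        coprimep (\big[@gcdp F/0]_(j < l) rrep m (k i j)) (h i)) ->
     (self_orthogonal (@ipS F (m * l))
        (qc_code m l t (fun i j => k i j * g i))
      <->
      (forall r s, (r <= s)%N -> (s < t)%N ->
         h r %| rrep m (rbar m (g s) *
                  \sum_(j < l./2) (rrep m (k r j) * rbar m (k s (l./2 + j)%N)
                                   - rrep m (k r (l./2 + j)%N) * rbar m (k s j)))))).
Proof.
split; [|split].
- by move=> F g k h _ g_dvd _; apply: euclidean_self_orthogonalP.
- by move=> q F g k cardF h _ g_dvd _; apply: hermitian_self_orthogonalP.
move=> l_even; have lE : l = (l./2 + l./2)%N by rewrite addnn even_halfK.
move: (l./2) lE => n -> F g k h _ g_dvd _.
exact: symplectic_self_orthogonalP.
Qed.
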